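(* Let $\Omega\subset\mathbb{R}^d$ be a bounded Lipschitz domain, let $m,\varepsilon,\tau,T>0$, and let $(\cdot,\cdot)_*$ be an inner product on $H^1(\Omega)$ with induced norm $\|\cdot\|_*$. Assume that there is a constant $c_{\rm Tr}>0$ such that for all $v\in H^1(\Omega)$ $$(1+\varepsilon)\,\|v\|_{L^1(\partial\Omega)}^2\le c_{\rm Tr}^2\,\|v\|_*^2+\|\nabla v\|^2 .$$ Let $u^0\in H^1(\Omega)$ with $\|u^0\|^2=1$ and let $u^1,u^2,\dots\in H^1(\Omega)$ be the iterates of the semi-implicit scheme described in the context. Then for every $K=0,1,\dots,\lfloor T/\tau\rfloor$ we have $$J_{m,\varepsilon}(u^K)+2\Big(1-\frac{c_{\rm Tr}^2\,\tau}{2m}\Big)\,\tau\sum_{k=1}^K\|d_tu^k\|_*^2\le J_{m,\varepsilon}(u^0)+\frac{\varepsilon}{m}\,T\,(1+\varepsilon)\,|\partial\Omega|^2 .$$ Moreover, since $\|u^0\|^2=1$, we have $$\|u^K\|^2=1+\tau^2\sum_{k=1}^K\|d_tu^k\|^2 ,$$ in particular $\|u^K\|\ge 1$; and if there is a constant $c_*$ with $\|v\|\le c_*\|v\|_*$ for all $v\in H^1(\Omega)$, then $$\big|\|u^K\|^2-1\big|\le c_{\rm U}\,\tau$$ with a constant $c_{\rm U}$ that does not depend on $\tau$ or $K$.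
   Context: $\|\cdot\|$ and $(\cdot,\cdot)$ denote the norm and inner product of $L^2(\Omega)$ (scalar- or vector-valued), and $|\partial\Omega|$ is the surface measure of $\partial\Omega$. For $a\in\mathbb{R}$ and $\varepsilon>0$ the regularized modulus is $|a|_\varepsilon=(a^2+\varepsilon^2)^{1/2}$, and for $u\in H^1(\Omega)$ (with traces understood on $\partial\Omega$) $$\|u\|_{L^1_\varepsilon(\partial\Omega)}=\int_{\partial\Omega}|u|_\varepsilon\,ds,\qquad J_{m,\varepsilon}(u)=\|\nabla u\|^2+\frac1m\|u\|_{L^1_\varepsilon(\partial\Omega)}^2 .$$ The backward difference quotient is $d_tu^k=(u^k-u^{k-1})/\tau$. Semi-implicit scheme: given $u^0\in H^1(\Omega)$ with $\|u^0\|^2=1$, for $k=1,2,\dots$ the iterate $u^k\in H^1(\Omega)$ is determined from $u^{k-1}$ by the requirements $(d_tu^k,u^{k-1})=0$ and $$(d_tu^k,v)_*+(\nabla u^k,\nabla v)+\frac1m\,\|u^{k-1}\|_{L^1_\varepsilon(\partial\Omega)}\int_{\partial\Omega}\frac{u^k\,v}{|u^{k-1}|_\varepsilon}\,ds=0$$ for all $v\in H^1(\Omega)$ with $(v,u^{k-1})=0$. (In the algorithm the iteration is stopped once $\|d_tu^k\|_*$ is below a tolerance; the statement concerns the iterates that are computed.) *)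

(* Defs.v *)
From HB Require Import structures.
From mathcomp Require Import all_boot all_order all_algebra.
From mathcomp Require Import all_classical all_reals all_analysis.
Set Implicit Arguments.
Unset Strict Implicit.
Unset Printing Implicit Defensive.
Import Order.TTheory GRing.Theory Num.Theory.
Import numFieldNormedType.Exports.
Local Open Scope classical_set_scope.
Local Open Scope ring_scope.

(* Conventions.  The ambient space R^d, d >= 1, is 'rV[R]_d with d = n.+1; its
   topology is the library's (generated by the sup norm), distances and
   diameters below are Euclidean. *)

Section outer_measures.
Context {R : realType} {T : pointedType}.
Local Open Scope ereal_scope.

(* inf of \sum_k g (F k) over all countable covers F: every set is measurable
   in g_sigma_algebraType setT, so mu_ext does not restrict the covers. *)
Definition gauge_outer (g : set T -> \bar R) (A : set T) : \bar R :=
  @mu_ext _ (g_sigma_algebraType (@setT (set T))) R g A.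

Section gauge_outer_lemmas.
Variable g : set T -> \bar R.
Let D := g_sigma_algebraType (@setT (set T)).
Hypotheses (g0 : g set0 = 0) (g_ge0 : forall A, 0 <= g A).

Lemma gauge_outer0 : gauge_outer g set0 = 0.
Proof. exact: (@mu_ext0 _ D R g g0 g_ge0). Qed.

Lemma gauge_outer_ge0 A : 0 <= gauge_outer g A.
Proof. exact: (@mu_ext_ge0 _ D R g g_ge0). Qed.

Lemma le_gauge_outer : {homo gauge_outer g : A B / A `<=` B >-> A <= B}.
Proof. exact: (@le_mu_ext _ D R g). Qed.

Lemma gauge_outer_sigma_subadditive : sigma_subadditive (gauge_outer g).
Proof. exact: (@mu_ext_sigma_subadditive _ D R g g_ge0). Qed.
End gauge_outer_lemmas.

Definition outer_restr (mu : set T -> \bar R) (D A : set T) : \bar R :=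
  mu (A `&` D).

Section outer_restr_instance.
Variables (mu : {outer_measure set T -> \bar R}) (D : set T).

Lemma outer_restr0 : outer_restr mu D set0 = 0.
Proof. by rewrite /outer_restr set0I outer_measure0. Qed.

Lemma outer_restr_ge0 A : 0 <= outer_restr mu D A.
Proof. exact: outer_measure_ge0. Qed.

Lemma le_outer_restr : {homo outer_restr mu D : A B / A `<=` B >-> A <= B}.
Proof. by move=> A B AB; apply: le_outer_measure; exact: setSI. Qed.

Lemma outer_restr_sigma_subadditive : sigma_subadditive (outer_restr mu D).
Proof.
by move=> F; rewrite /outer_restr setI_bigcupl; exact: outer_measure_sigma_subadditive.
Qed.

HB.instance Definition _ := isOuterMeasure.Build R T (outer_restr mu D)
  outer_restr0 outer_restr_ge0 le_outer_restr outer_restr_sigma_subadditive.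
End outer_restr_instance.

(* mu restricted to D, as a measure.  For a Caratheodory measurable D this is
   the usual restriction of the measure induced by mu; restricting the outer
   measure instead makes sense for every D. *)
Definition measure_on (mu : {outer_measure set T -> \bar R}) (D : set T) :=
  let nu : {outer_measure set T -> \bar R} := outer_restr mu D in
  [the {measure set (caratheodory_type nu) -> \bar R} of
     (nu : set (caratheodory_type nu) -> \bar R)].

End outer_measures.

Section euclidean_space.
Context {R : realType}.

Definition dot n (x y : 'rV[R]_n) : R := \sum_i x 0 i * y 0 i.
Definition enorm n (x : 'rV[R]_n) : R := Num.sqrt (dot x x).

(* The diameter of set0 is -oo. *)
Definition ediam n (A : set 'rV[R]_n) : \bar R :=
  ereal_sup [set (enorm (p.1 - p.2))%:E | p in A `*` A].

Section lebesgue.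
Variable n : nat.
Local Notation V := 'rV[R]_n.+1.
Local Open Scope ereal_scope.

Definition box (a b : V) : set V :=
  [set x | forall i, (a 0%R i < x 0%R i <= b 0%R i)%R].

(* The volume of a box, and +oo for a set that is not a box. *)
Definition box_volume (A : set V) : \bar R :=
  ereal_inf [set (\prod_i (p.2 0%R i - p.1 0%R i)%R)%:E | p in
    [set p : V * V | (forall i, (p.1 0%R i <= p.2 0%R i)%R) /\ A = box p.1 p.2]].

Definition lebesgue_outer : set V -> \bar R := gauge_outer box_volume.

Lemma box_volume_ge0 A : 0 <= box_volume A.
Proof.
apply: le_ereal_inf_tmp => _ [p [ple _] <-].
by rewrite lee_fin; apply: prodr_ge0 => i _; rewrite subr_ge0.
Qed.

Lemma box_volume0 : box_volume set0 = 0.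
Proof.
apply/eqP; rewrite eq_le box_volume_ge0 andbT; apply: ereal_inf_lbound.
exists (0%R, 0%R) => /=; last by rewrite big_ord_recl /= subrr mul0r.
split=> //; apply/seteqP; split=> [x []|x /(_ ord0) /andP[]].
by move=> /lt_le_trans h /h; rewrite ltxx.
Qed.

HB.instance Definition _ := isOuterMeasure.Build R V lebesgue_outer
  (gauge_outer0 box_volume0 box_volume_ge0) (gauge_outer_ge0 box_volume_ge0)
  (@le_gauge_outer _ _ box_volume) (gauge_outer_sigma_subadditive box_volume_ge0).

End lebesgue.

(* Volume of the Euclidean unit ball of R^s: 1, 2, and then
   omega_(s+2) = 2 pi omega_s / (s+2). *)
Fixpoint unit_ball_volume (s : nat) : R :=
  match s with
  | 0 => 1
  | 1 => 2
  | t.+2 => 2 * pi * unit_ball_volume t / t.+2%:R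
  end.

Section hausdorff.
Variables (n s : nat).
Local Notation V := 'rV[R]_n.+1.
Local Open Scope ereal_scope.

Definition hausdorff_gauge (delta : R) (A : set V) : \bar R :=
  if A == set0 then 0
  else if ediam A <= delta%:E
       then (unit_ball_volume s * (fine (ediam A) / 2) ^+ s)%R%:E
       else +oo.

(* The s-dimensional Hausdorff outer measure, normalised so that it agrees with
   s-dimensional area. *)
Definition hausdorff (A : set V) : \bar R :=
  ereal_sup [set gauge_outer (hausdorff_gauge delta) A |
             delta in [set delta : R | (0 < delta)%R]].

Lemma unit_ball_volume_ge0 t : (0 <= unit_ball_volume t)%R.
Proof.
suff : (0 <= unit_ball_volume t)%R /\ (0 <= unit_ball_volume t.+1)%R by case.
elim: t => [|t [h1 h2]]; first by split; rewrite /= ?ler01.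
by split=> //=; rewrite !mulr_ge0 ?pi_ge0 ?invr_ge0.
Qed.

Lemma hausdorff_gauge0 delta : hausdorff_gauge delta set0 = 0.
Proof. by rewrite /hausdorff_gauge eqxx. Qed.

Lemma ediam_ge0 (A : set V) : A !=set0 -> 0 <= ediam A.
Proof.
move=> [x Ax]; apply: (@le_trans _ _ (enorm (x - x))%:E).
  by rewrite lee_fin; exact: sqrtr_ge0.
by apply: ereal_sup_ubound; exists (x, x).
Qed.

Lemma hausdorff_gauge_ge0 delta A : 0 <= hausdorff_gauge delta A.
Proof.
rewrite /hausdorff_gauge; case: eqP => // /eqP /set0P A0.
case: ifP => // _; rewrite lee_fin mulr_ge0 ?unit_ball_volume_ge0//.
by rewrite exprn_ge0// divr_ge0// fine_ge0// ediam_ge0.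
Qed.

Lemma hausdorff_ub delta A : (0 < delta)%R ->
  gauge_outer (hausdorff_gauge delta) A <= hausdorff A.
Proof. by move=> d0; apply: ereal_sup_ubound; exists delta. Qed.

Lemma hausdorff_ge0 A : 0 <= hausdorff A.
Proof.
apply: le_trans (hausdorff_ub A ltr01).
exact: (gauge_outer_ge0 (@hausdorff_gauge_ge0 1)).
Qed.

Lemma hausdorff0 : hausdorff set0 = 0.
Proof.
apply/eqP; rewrite eq_le hausdorff_ge0 andbT.
apply: ge_ereal_sup => _ [delta _ <-].
by rewrite (gauge_outer0 (hausdorff_gauge0 delta) (@hausdorff_gauge_ge0 delta)).
Qed.

Lemma le_hausdorff : {homo hausdorff : A B / A `<=` B >-> A <= B}.
Proof.
move=> A B AB; apply: ge_ereal_sup => _ [delta d0 <-].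
apply: le_trans (hausdorff_ub B d0).
exact: le_gauge_outer.
Qed.

Lemma hausdorff_sigma_subadditive : sigma_subadditive hausdorff.
Proof.
move=> F; apply: ge_ereal_sup => _ [delta d0 <-].
apply: le_trans (gauge_outer_sigma_subadditive (@hausdorff_gauge_ge0 delta) F) _.
apply: lee_nneseries => k _; last exact: hausdorff_ub.
by move=> ?; exact: (gauge_outer_ge0 (@hausdorff_gauge_ge0 delta)).
Qed.

HB.instance Definition _ := isOuterMeasure.Build R V hausdorff
  hausdorff0 hausdorff_ge0 le_hausdorff hausdorff_sigma_subadditive.

End hausdorff.
End euclidean_space.

Section domains.
Context {R : realType} {n : nat}.
Local Notation V := 'rV[R]_n.+1.
Implicit Type Omega : set V.

Definition frontier Omega : set V := closure Omega `\` Omega°.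

(* Near each boundary point, after a rigid motion y |-> y *m Q, Omega is the
   set of points lying strictly above the graph of a Lipschitz function of the
   coordinates other than the last one. *)
Definition lipschitz_boundary Omega : Prop :=
  forall x, frontier Omega x ->
  exists (r : R) (Q : 'M[R]_n.+1) (phi : 'rV[R]_n -> R),
    [/\ 0 < r, Q *m Q^T = 1%:M,
        exists L : R, forall y z, `|phi y - phi z| <= L * enorm (y - z)
      & forall y : V, enorm (y - x) < r ->
          (Omega y <->
           phi (\row_j (y *m Q) 0 (lift ord_max j)) < (y *m Q) 0 ord_max)].

Definition bounded_lipschitz_domain Omega : Prop :=
  [/\ Omega !=set0, open Omega, connected Omega, bounded_set Omega
    & lipschitz_boundary Omega].

(* (Omega, dx) and (boundary of Omega, ds) *)
Definition volume Omega := measure_on (@lebesgue_outer R n) Omega.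
Definition surface Omega := measure_on (@hausdorff R n n) (frontier Omega).

Definition surface_area Omega : R := fine (surface Omega setT).

End domains.

Section sobolev.
Context {R : realType} {n : nat}.
Local Notation V := 'rV[R]_n.+1.
Variable Omega : set V.

Definition partial (i : 'I_n.+1) (f : V -> R) : V -> R :=
  fun x => 'D_('e_i) f x.

Definition iter_partial (s : seq 'I_n.+1) (f : V -> R) : V -> R :=
  foldr partial f s.

Definition smooth (f : V -> R) : Prop := forall s : seq 'I_n.+1,
  continuous (iter_partial s f) /\
  forall i x, derivable (iter_partial s f) x 'e_i.

Definition test_function (phi : V -> R) : Prop :=
  smooth phi /\
  exists K : set V, [/\ compact K, K `<=` Omega & forall x, ~ K x -> phi x = 0].

(* An element u of H^1 is represented by the pair of the function u.1 and of
   its weak gradient u.2 (which u.1 determines almost everywhere in Omega). *)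
Definition fun_grad := ((V -> R) * (V -> V))%type.

Definition l2 (f : V -> R) : Prop := f \in Lfun (volume Omega) 2%:E.

Definition weak_gradient (u : V -> R) (G : V -> V) : Prop :=
  forall (phi : V -> R) (i : 'I_n.+1), test_function phi ->
    \int[volume Omega]_x (u x * partial i phi x) =
    - \int[volume Omega]_x (G x 0 i * phi x).

Definition H1 : set fun_grad :=
  [set u : fun_grad | [/\ l2 u.1, forall i, l2 (fun x => u.2 x 0 i)
             & weak_gradient u.1 u.2]].

Definition l2dot (u v : fun_grad) : R := \int[volume Omega]_x (u.1 x * v.1 x).
Definition l2norm (u : fun_grad) : R := Num.sqrt (l2dot u u).
Definition grad_dot (u v : fun_grad) : R :=
  \int[volume Omega]_x dot (u.2 x) (v.2 x).
Definition grad_norm (u : fun_grad) : R := Num.sqrt (grad_dot u u).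

(* An inner product on H^1, whose elements are functions modulo almost
   everywhere equality in Omega. *)
Definition H1_inner_product (s : fun_grad -> fun_grad -> R) : Prop :=
  [/\ forall u v, H1 u -> H1 v -> s u v = s v u,
      forall a u v w, H1 u -> H1 v -> H1 w ->
        s (a *: u + v) w = a * s u w + s v w,
      forall u, H1 u -> 0 <= s u u
    & forall u, H1 u ->
        (s u u = 0 <-> {ae volume Omega, forall x, u.1 x = 0})].

(* The bounded linear operators H^1(Omega) -> L^2(boundary) extending the
   restriction of functions that are continuous up to the boundary.  By the
   trace theorem there is exactly one, up to almost everywhere equality, for a
   bounded Lipschitz domain. *)
Definition trace_operator (T : fun_grad -> V -> R) : Prop :=
  [/\ forall u, H1 u -> T u \in Lfun (surface Omega) 2%:E,
      forall a u v, H1 u -> H1 v ->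
        {ae surface Omega, forall x, T (a *: u + v) x = a * T u x + T v x},
      exists C : R, forall u, H1 u ->
        \int[surface Omega]_x (T u x) ^+ 2 <=
        C * (l2norm u ^+ 2 + grad_norm u ^+ 2)
    & forall u, H1 u -> {within closure Omega, continuous u.1} ->
        {ae surface Omega, forall x, T u x = u.1 x}].

Definition trace : fun_grad -> V -> R := xget (fun=> cst 0) trace_operator.

Definition l1_bdry (u : fun_grad) : R := \int[surface Omega]_x `|trace u x|.

Definition regabs (eps a : R) : R := Num.sqrt (a ^+ 2 + eps ^+ 2).

Definition l1_bdry_reg (eps : R) (u : fun_grad) : R :=
  \int[surface Omega]_x regabs eps (trace u x).

Definition J (m eps : R) (u : fun_grad) : R :=
  grad_norm u ^+ 2 + m^-1 * l1_bdry_reg eps u ^+ 2.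

End sobolev.

Section scheme.
Context {R : realType} {n : nat}.
Variables (Omega : set 'rV[R]_n.+1) (m eps tau : R).
Variable star : @fun_grad R n -> @fun_grad R n -> R.

(* d_t u^k *)
Definition dt (u : nat -> @fun_grad R n) (k : nat) : @fun_grad R n :=
  tau^-1 *: (u k - u k.-1).

Definition semi_implicit_step (u : nat -> @fun_grad R n) (k : nat) : Prop :=
  [/\ H1 Omega (u k), l2dot Omega (dt u k) (u k.-1) = 0
    & forall v, H1 Omega v -> l2dot Omega v (u k.-1) = 0 ->
        star (dt u k) v + grad_dot Omega (u k) v
        + m^-1 * l1_bdry_reg Omega eps (u k.-1)
          * \int[surface Omega]_x (trace Omega (u k) x * trace Omega v x
                                   / regabs eps (trace Omega (u k.-1) x)) = 0].

(* u 0, ..., u K are the iterates computed from the initial value u0; nothing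
   is required beyond K, where the algorithm may have stopped. *)
Definition semi_implicit_iterates (u0 : @fun_grad R n) (K : nat)
    (u : nat -> @fun_grad R n) : Prop :=
  u 0 = u0 /\ forall k, (1 <= k <= K)%N -> semi_implicit_step u k.

Definition star_norm (u : @fun_grad R n) : R := Num.sqrt (star u u).

End scheme.

(* Main.v *)
(* Testing the scheme with [v = d_t u^k] gives unconditional stability,
   [J(u^k) + 2 tau |d_t u^k|_*^2 <= J(u^{k-1})]: for the boundary term, with
   [A = |u^k|_eps] and [B = |u^{k-1}|_eps], the integrand dominates
   [(A^2 - B^2) / (2 tau B)], and Cauchy-Schwarz gives
   [(int A)^2 <= (int B) (int A^2/B)]. Summation gives the claimed estimate, as
   the terms with [c_Tr] and [|dOmega|] only weaken it. The orthogonality of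
   [d_t u^k] to [u^{k-1}] gives the identity for [|u^K|^2].

   Testing requires [d_t u^k] in [H^1]. Linearity of the integrals in the
   definition of weak gradients rests on continuous functions being measurable
   for the Caratheodory sigma-algebra of [lebesgue_outer], that is, on
   half-spaces splitting boxes additively. *)

Require Import Defs.
From HB Require Import structures.
From mathcomp Require Import all_boot all_order all_algebra.
From mathcomp Require Import all_classical all_reals all_analysis.
From mathcomp Require Import measurable_realfun ring lra.
Set Implicit Arguments.
Unset Strict Implicit.
Unset Printing Implicit Defensive.
Import Order.TTheory GRing.Theory Num.Theory.
Import numFieldNormedType.Exports.
Local Open Scope classical_set_scope.
Local Open Scope ring_scope.

(** * Caratheodory measurability for the Lebesgue outer measure, and finite volume *)

Section lebesgue_measurability.
Context {R : realType} {n : nat}.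
Local Notation V := 'rV[R]_n.+1.

(** Cutting a box by a hyperplane [x 0 i = c] moves one coordinate of one of its corners. *)
Definition set_coord (p : V) (i : 'I_n.+1) (c : R) : V :=
  \row_j (if j == i then c else p 0 j).

Lemma set_coordE p i c j : set_coord p i c 0 j = if j == i then c else p 0 j.
Proof. by rewrite mxE. Qed.

Lemma box_volume_le (p q : V) : (forall i, p 0 i <= q 0 i) ->
  (box_volume (box p q) <= (\prod_i (q 0 i - p 0 i))%:E)%E.
Proof. by move=> pq; apply: ereal_inf_lbound; exists (p, q). Qed.

(** The hyperplane cuts a half-open box into two half-open boxes that share all edges but the
    [i]-th, and these two edges add up to the original one. If [A] is not a box, the right side is
    an infimum over the empty set, hence [+oo]. *)
Lemma box_volume_split (A : set V) (i : 'I_n.+1) (c : R) :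
  (box_volume (A `&` [set x : V | (x 0 i <= c)%R]) +
   box_volume (A `&` ~` [set x : V | (x 0 i <= c)%R]) <= box_volume A)%E.
Proof.
set H := [set x | _]; apply: le_ereal_inf_tmp => _ [[p q] /= [pq ->] <-].
(* Clamping [c] to the [i]-th edge keeps the corners of both pieces ordered even when the hyperplane
   misses the box; one piece is then empty. *)
set c' := Num.max (p 0 i) (Num.min (q 0 i) c).
have pc' : p 0 i <= c' by rewrite le_max lexx.
have c'q : c' <= q 0 i by rewrite ge_max pq ge_min lexx.
have -> : box p q `&` H = box p (set_coord q i c').
  apply/seteqP; split=> x /=.
    move=> [xb xc] j; rewrite set_coordE; case: eqP => [->|_]; last exact: xb.
    have /andP[-> xq] := xb i; rewrite /= /c' le_max le_min xq.
    by rewrite [x 0 i <= c]xc orbT.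
  move=> xb; split.
    move=> j; have := xb j; rewrite set_coordE; case: eqP => [->|_] //.
    by move=> /andP[-> xc']; rewrite (le_trans xc').
  have := xb i; rewrite set_coordE eqxx => /andP[px]; rewrite /c' /H/=.
  by rewrite le_max le_min => /orP[|/andP[//]]; rewrite leNgt px.
have -> : box p q `&` ~` H = box (set_coord p i c') q.
  apply/seteqP; split=> x /=.
    move=> [xb /negP xc] j; rewrite set_coordE; case: eqP => [->|_]; last exact: xb.
    have /andP[px xq] := xb i; rewrite xq andbT /c' gt_max px gt_min.
    by rewrite [c < x 0 i]ltNge xc orbT.
  move=> xb; split.
    move=> j; have := xb j; rewrite set_coordE; case: eqP => [->|_] //.
    by move=> /andP[c'x ->]; rewrite (le_lt_trans pc').
  have := xb i; rewrite set_coordE eqxx => /andP[c'x xq] /= xc.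
  move: c'x; rewrite /c' gt_max gt_min => /andP[_ /orP[]].
    by rewrite ltNge xq.
  by rewrite ltNge xc.
apply: (@le_trans _ _ ((\prod_j ((set_coord q i c') 0 j - p 0 j))%:E +
    (\prod_j (q 0 j - (set_coord p i c') 0 j))%:E)%E).
  by apply: leeD; apply: box_volume_le => j; rewrite set_coordE; case: eqP => [->|].
rewrite -EFinD lee_fin (bigD1 i)//= [X in _ + X](bigD1 i)//= [leRHS](bigD1 i)//=.
rewrite !set_coordE eqxx.
rewrite (eq_bigr (fun j => q 0 j - p 0 j)); last first.
  by move=> j /negbTE ji; rewrite set_coordE ji.
rewrite [X in _ + _ * X](eq_bigr (fun j => q 0 j - p 0 j)); last first.
  by move=> j /negbTE ji; rewrite set_coordE ji.
by rewrite -mulrDl addrC addrA subrK.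
Qed.

(** Intersecting a cover of [X] with the half-space and with its complement gives covers of both
    parts of [X], whose total gauge does not grow by [box_volume_split]. *)
Lemma halfspace_caratheodory (i : 'I_n.+1) (c : R) :
  (@lebesgue_outer R n).-caratheodory [set x : V | x 0 i <= c].
Proof.
apply: (@le_caratheodory_measurable _ _ (@lebesgue_outer R n)) => X.
set H := [set x | _].
apply: le_ereal_inf_tmp => _ [F [_ XF] <-].
apply: (@le_trans _ _ (\sum_(k <oo) (box_volume (F k `&` H) +
    box_volume (F k `&` ~` H)))%E); last first.
  apply: lee_nneseries => k _; last exact: box_volume_split.
  by move=> _; rewrite adde_ge0// box_volume_ge0.
rewrite nneseriesD; try by move=> *; exact: box_volume_ge0.
by apply: leeD; apply: ereal_inf_lbound; eexists; try reflexivity;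
  (split; [move=> k; exact: (@sub_sigma_algebra _ setT setT)
  | rewrite -setI_bigcupl; exact: setSI]).
Qed.

(** Splitting [X] under the restriction is splitting [X] intersected with [D] under [mu]. *)
Lemma caratheodory_outer_restr (mu : {outer_measure set V -> \bar R}) (D A : set V) :
  mu.-caratheodory A -> (outer_restr mu D).-caratheodory A.
Proof.
move=> mA X; rewrite /outer_restr (mA (X `&` D)).
by congr (mu _ + mu _)%E; rewrite setIAC.
Qed.

Variable Omega : set V.
Let nu : {outer_measure set V -> \bar R} := outer_restr (@lebesgue_outer R n) Omega.
Local Notation T := (caratheodory_type nu).

Lemma measurable_halfspace (i : 'I_n.+1) (c : R) :
  measurable ([set x : V | x 0 i <= c] : set T).
Proof. exact/caratheodory_outer_restr/halfspace_caratheodory. Qed.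

Lemma measurable_box (p q : V) : measurable (box p q : set T).
Proof.
have -> : box p q = \bigcap_(i in [set: 'I_n.+1])
    (~` [set x : V | x 0 i <= p 0 i] `&` [set x : V | x 0 i <= q 0 i]).
  apply/seteqP; split=> x /= xpq i.
    by move=> _; have /andP[px xq] := xpq i; split => //=; apply/negP; rewrite -ltNge.
  by have [/= /negP + ->] := xpq i I; rewrite -ltNge andbT.
apply: (@fin_bigcap_measurable _ T) => // i _.
by apply: (@measurableI _ T); [apply: (@measurableC _ T)|]; exact: measurable_halfspace.
Qed.

(** An open set is the union of the boxes with rational corners that it contains, and there are
    countably many of these. Balls of the sup norm are cubes, so each one contains such a box around
    its centre. *)
Lemma measurable_open (U : set V) : open U -> measurable (U : set T).
Proof.
move=> oU.
pose b (r : 'rV[rat]_n.+1 * 'rV[rat]_n.+1) : set V :=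
  box (map_mx ratr r.1) (map_mx ratr r.2).
have -> : U = \bigcup_(r in [set r | b r `<=` U]) b r.
  apply/seteqP; split=> [x Ux|x [r /= rU]]; last exact: rU.
  have /nbhs_ballP[e /= e0 eU] : nbhs x U by exact: open_nbhs_nbhs.
  have lo i : exists r : rat, ratr r \in `](x 0 i - e), (x 0 i)[.
    by apply: rat_in_itvoo; rewrite ltrBlDr ltrDl.
  have hi i : exists r : rat, ratr r \in `](x 0 i), (x 0 i + e)[.
    by apply: rat_in_itvoo; rewrite ltrDl.
  have [lo_ loP] := choice lo; have [hi_ hiP] := choice hi.
  exists (\row_i lo_ i, \row_i hi_ i) => /=.
    move=> y yb; apply: eU; split=> // i j; rewrite (ord1 i) /ball/=.
    have := yb j; have := loP j; have := hiP j; rewrite !mxE !in_itv/=.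
    move=> /andP[h1 h2] /andP[l1 l2] /andP[y1 y2].
    by rewrite ltr_distlC; apply/andP; split; lra.
  move=> i; have := loP i; have := hiP i; rewrite !mxE !in_itv/=.
  by move=> /andP[h1 h2] /andP[l1 l2]; rewrite l2 ltW.
rewrite bigcup_mkcond; apply: (@countable_bigcupT_measurable _ T).
  exact: countableP.
by move=> r; case: ifPn => // _; exact: measurable_box.
Qed.

Lemma continuous_measurable (f : V -> R) :
  continuous f -> measurable_fun [set: T] (f : T -> R).
Proof.
move=> /continuousP cf; apply: (measurability _ (RGenOpens.measurableE R)).
move=> _ [_ [a [b ->] <-]]; rewrite setTI.
exact/measurable_open/cf/interval_open.
Qed.

Lemma volume_finite : bounded_set Omega -> (volume Omega setT < +oo)%E.
Proof.
move=> /pinfty_ex_gt0[M M0 OM].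
rewrite /volume /measure_on /= /outer_restr setTI.
(* Boxes are open on the lower side, so the lower corner lies strictly below [- M]. *)
pose p : V := const_mx (- (M + 1)); pose q : V := const_mx M.
have Opq : Omega `<=` box p q.
  move=> x /OM; rewrite /= -[`|x|]/(mx_norm x) mx_normrE => xM i; rewrite !mxE.
  have : `|x 0 i| <= M.
    apply: le_trans xM; exact: (le_bigmax _ (fun i : 'I_1 * 'I_n.+1 => `|x i.1 i.2|) (0, i)).
  by rewrite ler_norml => /andP[x1 x2]; apply/andP; split; lra.
apply: le_lt_trans (le_outer_measure (@lebesgue_outer R n) _ _ Opq) _.
apply: (@le_lt_trans _ _ (box_volume (box p q))); last first.
  by apply: le_lt_trans (box_volume_le _) (ltry _) => i; rewrite !mxE; lra.
(* A single box, padded with empty sets, is a countable cover. *)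
pose F (k : nat) : set V := if k == 0%N then box p q else set0.
apply: ereal_inf_lbound; exists F.
  split; first by move=> k; exact: (@sub_sigma_algebra _ setT setT).
  by move=> x xpq; exists 0%N.
rewrite (nneseries_split 0 1); last by move=> *; exact: box_volume_ge0.
rewrite big_ltn// big_geq// adde0 eseries0 ?adde0// => -[//|k] _ _.
exact: box_volume0.
Qed.

End lebesgue_measurability.

(** * Products of square integrable functions and monotonicity of the integral *)

Section square_integrable.
Context d {T : measurableType d} {R : realType} (mu : {measure set T -> \bar R}).
Implicit Types f g : T -> R.

Lemma Lfun2_measurable f : f \in Lfun mu 2%:E -> measurable_fun setT f.
Proof. by rewrite inE => /andP[/[!inE]]. Qed.

Lemma Lfun2_lin f g a : f \in Lfun mu 2%:E -> g \in Lfun mu 2%:E ->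
  (fun x => a * f x + g x) \in Lfun mu 2%:E.
Proof.
have [_ h] := @Lfun_submod_closed _ _ _ mu _ (lee1n 2).
by move=> fL gL; exact: (h a f g).
Qed.

Lemma Lfun2_mul_integrable f g : f \in Lfun mu 2%:E -> g \in Lfun mu 2%:E ->
  mu.-integrable setT (EFin \o (fun x => f x * g x)).
Proof. by move=> fL gL; apply/Lfun1_integrable; exact: Lfun2_mul_Lfun1. Qed.

Lemma integrable_mul_bounded f g (M : R) :
  mu.-integrable setT (EFin \o f) -> measurable_fun setT g ->
  (forall x, `|g x| <= M) -> mu.-integrable setT (EFin \o (fun x => f x * g x)).
Proof.
move=> fI mg gM.
have mf : measurable_fun setT f by apply/measurable_EFinP; exact: measurable_int fI.
apply: (le_integrable measurableT _ _ (integrableZl measurableT M fI)).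
  by apply/measurable_EFinP; exact: measurable_funM.
move=> x _ /=; rewrite lee_fin normrM mulrC [leRHS]normrM ler_wpM2r//.
exact: le_trans (ler_norm _).
Qed.

Lemma Rintegral_sqr_lin (w b : T -> R) tau :
  w \in Lfun mu 2%:E -> b \in Lfun mu 2%:E ->
  \int[mu]_x ((tau * w x + b x) * (tau * w x + b x)) =
  \int[mu]_x (b x * b x) + 2 * tau * \int[mu]_x (w x * b x)
    + tau ^+ 2 * \int[mu]_x (w x * w x).
Proof.
move=> wL bL.
have bb := Lfun2_mul_integrable bL bL.
have wb := Lfun2_mul_integrable wL bL.
have ww := Lfun2_mul_integrable wL wL.
rewrite -!RintegralZl// -!RintegralD//; first last.
- exact: (integrableZl measurableT (2 * tau) wb).
- exact: (integrableZl measurableT (tau ^+ 2) ww).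
- exact: (integrableD measurableT bb (integrableZl measurableT (2 * tau) wb)).
by apply: eq_Rintegral => x _; ring.
Qed.

End square_integrable.

Section ae_monotone.
Context d {T : measurableType d} {R : realType} (mu : {measure set T -> \bar R}).

(** Serves for traces, which are linear only almost everywhere: [g - f] agrees almost everywhere
    with its absolute value, whose integral is nonnegative. *)
Lemma ae_le_Rintegral (f g : T -> R) :
  mu.-integrable setT (EFin \o f) -> mu.-integrable setT (EFin \o g) ->
  {ae mu, forall x, f x <= g x} -> \int[mu]_x f x <= \int[mu]_x g x.
Proof.
move=> fI gI fg; rewrite -subr_ge0 -RintegralB//.
have mfg : measurable_fun setT (fun x => g x - f x).
  by apply: measurable_funB; apply/measurable_EFinP;
    [exact: measurable_int gI|exact: measurable_int fI].
have -> : \int[mu]_x (g x - f x) = \int[mu]_x `|g x - f x|.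
  congr fine; apply: ae_eq_integral => //.
  - exact/measurable_EFinP.
  - by apply/measurable_EFinP; exact: measurableT_comp.
  - by apply: filterS fg => x fgx _; rewrite ger0_norm// subr_ge0.
exact: Rintegral_ge0.
Qed.

End ae_monotone.

(** * The regularized modulus and a discriminant inequality *)

Section regularized_modulus.
Context {R : realType}.
Implicit Types a b eps : R.

Lemma regabs_ge eps a : 0 < eps -> eps <= regabs eps a.
Proof.
move=> e0; have -> : eps = Num.sqrt (eps ^+ 2) by rewrite sqrtr_sqr gtr0_norm.
by apply: ler_wsqrtr; rewrite sqr_sqrtr ?sqr_ge0// lerDr sqr_ge0.
Qed.

Lemma regabs_gt0 eps a : 0 < eps -> 0 < regabs eps a.
Proof. by move=> e0; exact: lt_le_trans (regabs_ge a e0). Qed.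

Lemma sqr_regabs eps a : regabs eps a ^+ 2 = a ^+ 2 + eps ^+ 2.
Proof. by rewrite sqr_sqrtr// addr_ge0// sqr_ge0. Qed.

Lemma regabs_le eps a : 0 < eps -> regabs eps a <= `|a| + eps.
Proof.
move=> e0; have -> : `|a| + eps = Num.sqrt ((`|a| + eps) ^+ 2).
  by rewrite sqrtr_sqr [RHS]ger0_norm// addr_ge0// ltW.
apply: ler_wsqrtr; rewrite sqrrD real_normK ?num_real//.
by rewrite lerD2r lerDl mulrn_wge0// mulr_ge0// ltW.
Qed.

Lemma regabs_continuous eps : continuous (regabs eps).
Proof.
move=> x; rewrite (_ : regabs eps = Num.sqrt \o (fun y => y ^+ 2 + eps ^+ 2))//.
apply: continuous_comp.
  by apply: cvgD; [exact: exprn_continuous|exact: cvg_cst].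
exact: sqrt_continuous.
Qed.

Lemma regabsV_continuous eps : 0 < eps -> continuous (fun x => (regabs eps x)^-1).
Proof.
by move=> e0 x; apply: cvgV; [rewrite gt_eqF// regabs_gt0|exact: regabs_continuous].
Qed.

(** The discriminant argument behind Cauchy-Schwarz. *)
Lemma le_sqr_of_quadratic (P L I : R) : 0 <= P ->
  (forall t, 2 * t * L <= I + t ^+ 2 * P) -> L ^+ 2 <= P * I.
Proof.
rewrite le_eqVlt => /predU1P[<- h|P0 h].
  rewrite mul0r; have [->|L0] := eqVneq L 0; first by rewrite expr0n.
  (* For [P = 0] the bound is linear in [t]; this [t] makes its left side [I + 1], a
     contradiction. *)
  have := h ((I + 1) / (2 * L)).
  have -> : 2 * ((I + 1) / (2 * L)) * L = I + 1 by field.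
  by rewrite mulr0 addr0; lra.
(* This [t] minimises [I + t ^+ 2 * P - 2 * t * L]. *)
have := h (L / P).
have -> : 2 * (L / P) * L = 2 * L ^+ 2 / P by field; rewrite gt_eqF.
have -> : (L / P) ^+ 2 * P = L ^+ 2 / P by field; rewrite gt_eqF.
rewrite -lerBlDr -mulrBl (_ : 2 * L ^+ 2 - L ^+ 2 = L ^+ 2); last by ring.
by rewrite ler_pdivrMr// mulrC.
Qed.

End regularized_modulus.

(** * The boundary term of the energy *)

Section boundary_energy.
Context d {T : measurableType d} {R : realType} (mu : {measure set T -> \bar R}).
Variable eps : R.
Hypothesis eps_gt0 : 0 < eps.
Implicit Types a b w : T -> R.

Lemma measurable_regabs a : measurable_fun setT a ->
  measurable_fun setT (fun x => regabs eps (a x)).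
Proof.
exact: (measurableT_comp (continuous_measurable_fun (@regabs_continuous R eps))).
Qed.

(** The integrand is at least [eps], so the extended integral is [+oo], which [fine] sends to 0. *)
Lemma Rintegral_regabs_infinite a : measurable_fun setT a ->
  mu setT = +oo%E -> \int[mu]_x regabs eps (a x) = 0.
Proof.
move=> ma moo; rewrite /Rintegral.
suff -> : (\int[mu]_x (regabs eps (a x))%:E = +oo)%E by [].
apply/eqP; rewrite -leye_eq.
have <- : (\int[mu]_(x in setT) (cst eps%:E x) = +oo)%E.
  by rewrite integral_cst// moo gt0_muley// lte_fin.
apply: ge0_le_integral => //.
- by move=> x _; rewrite /= lee_fin ltW.
- by apply/measurable_EFinP; exact: measurable_regabs.
- by move=> x _; rewrite /= lee_fin regabs_ge.
Qed.

(** The dominating function is [|a| + eps]; on a finite measure space both summands are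
    integrable. *)
Lemma integrable_regabs a : (mu setT < +oo)%E -> a \in Lfun mu 2%:E ->
  mu.-integrable setT (EFin \o (fun x => regabs eps (a x))).
Proof.
move=> mufin aL; have ma := Lfun2_measurable aL.
have muF : mu setT \is a fin_num by rewrite ge0_fin_numE.
have aI : mu.-integrable setT (EFin \o a).
  by apply/Lfun1_integrable; exact: (Lfun_subset12 muF).
have cI : mu.-integrable setT (EFin \o cst eps).
  by apply: measurable_bounded_integrable => //; exact: bounded_cst.
apply: (le_integrable measurableT _ _ (integrableD measurableT (integrable_abse aI) cI)).
  by apply/measurable_EFinP; exact: measurable_regabs.
move=> x _ /=; rewrite lee_fin (gtr0_norm (regabs_gt0 _ eps_gt0)).
by apply: le_trans (ler_norm _); exact: regabs_le.
Qed.

Lemma measurable_regabsV b : measurable_fun setT b ->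
  measurable_fun setT (fun x => (regabs eps (b x))^-1).
Proof.
exact: (measurableT_comp (continuous_measurable_fun (regabsV_continuous eps_gt0))).
Qed.

Lemma regabsV_bounded b x : `|(regabs eps (b x))^-1| <= eps^-1.
Proof.
have B0 := regabs_gt0 (b x) eps_gt0.
by rewrite gtr0_norm ?invr_gt0// lef_pV2 ?posrE// regabs_ge.
Qed.

Lemma integrable_div_regabs f b : measurable_fun setT b ->
  mu.-integrable setT (EFin \o f) ->
  mu.-integrable setT (EFin \o (fun x => f x / regabs eps (b x))).
Proof.
move=> mb fI; apply: (@integrable_mul_bounded _ _ _ mu f _ eps^-1) => //.
  exact: measurable_regabsV.
exact: regabsV_bounded.
Qed.

(* Cauchy-Schwarz: [(int A)^2 <= int B * int A^2/B] for the regularised moduli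
   [A] of [a] and [B] of [b = a - tau w], while
   [2 tau a w >= a^2 - b^2 = A^2 - B^2] pointwise. If the measure is infinite,
   the integrals of [A] and [B] are [fine +oo = 0]. *)
Lemma regabs_energy a b w tau : 0 < tau ->
  a \in Lfun mu 2%:E -> b \in Lfun mu 2%:E -> w \in Lfun mu 2%:E ->
  {ae mu, forall x, a x = tau * w x + b x} ->
  (\int[mu]_x regabs eps (a x)) ^+ 2 - (\int[mu]_x regabs eps (b x)) ^+ 2
  <= 2 * tau * ((\int[mu]_x regabs eps (b x)) *
                \int[mu]_x (a x * w x / regabs eps (b x))).
Proof.
move=> tau0 aL bL wL awb.
have ma := Lfun2_measurable aL; have mb := Lfun2_measurable bL.
have mw := Lfun2_measurable wL.
have [mufin|] := ltP (mu setT) +oo%E; last first.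
  rewrite leye_eq => /eqP moo.
  by rewrite !Rintegral_regabs_infinite// mul0r mulr0 subrr.
set L := \int[mu]_x regabs eps (a x); set P := \int[mu]_x regabs eps (b x).
have AI := integrable_regabs mufin aL; have BI := integrable_regabs mufin bL.
have P0 : 0 <= P by apply: Rintegral_ge0 => x _; rewrite ltW// regabs_gt0.
have bbI := Lfun2_mul_integrable bL bL.
have aaI := Lfun2_mul_integrable aL aL.
have awI := Lfun2_mul_integrable aL wL.
have muF : mu setT \is a fin_num by rewrite ge0_fin_numE.
have eI : mu.-integrable setT (EFin \o cst (eps ^+ 2)).
  by apply: measurable_bounded_integrable => //; exact: bounded_cst.
(* This is [A^2/B], with [A^2] expanded so that integrability follows from that of [a * a] and of
   constants. *)
pose q x := (a x * a x + eps ^+ 2) / regabs eps (b x).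
have qI : mu.-integrable setT (EFin \o q).
  exact: (integrable_div_regabs mb (integrableD measurableT aaI eI)).
pose S := \int[mu]_x q x.
(* Integrating [(A - t B)^2 / B >= 0] gives the quadratic bound for every [t]. *)
have LPS : L ^+ 2 <= P * S.
  apply: le_sqr_of_quadratic => // t.
  rewrite -!RintegralZl// -RintegralD//; last exact: (integrableZl measurableT _ BI).
  apply: le_Rintegral => //; first exact: (integrableZl measurableT _ AI).
    exact: (integrableD measurableT qI (integrableZl measurableT _ BI)).
  move=> x _; have B0 := regabs_gt0 (b x) eps_gt0; rewrite /q -expr2 -sqr_regabs.
  rewrite -subr_ge0.
  have -> : regabs eps (a x) ^+ 2 / regabs eps (b x) + t ^+ 2 * regabs eps (b x)
     - 2 * t * regabs eps (a x)
     = (regabs eps (a x) - t * regabs eps (b x)) ^+ 2 / regabs eps (b x).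
    by field; rewrite gt_eqF.
  by rewrite divr_ge0 ?sqr_ge0 ?(ltW B0).
have SP : S - P <= 2 * tau * \int[mu]_x (a x * w x / regabs eps (b x)).
  have awVI := integrable_div_regabs mb awI.
  rewrite -RintegralZl// -RintegralB//.
  apply: ae_le_Rintegral => //.
  - exact: (integrableB measurableT qI BI).
  - exact: (integrableZl measurableT _ awVI).
  apply: filterS awb => x aE.
  have B0 := regabs_gt0 (b x) eps_gt0.
  have -> : q x - regabs eps (b x) = (a x ^+ 2 - b x ^+ 2) / regabs eps (b x).
    have Bn0 := lt0r_neq0 B0; apply: (mulIf Bn0).
    by rewrite /q mulrBl !divfK// -(expr2 (regabs _ _)) sqr_regabs; ring.
  rewrite mulrA ler_pM2r ?invr_gt0//.
  have -> : 2 * tau * (a x * w x) = 2 * a x * (a x - b x) by rewrite {3}aE; ring.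
  rewrite -subr_ge0 (_ : _ - _ = (a x - b x) ^+ 2) ?sqr_ge0//; ring.
(* By [LPS], [L^2 - P^2 <= P S - P^2 = P (S - P)], and [SP] is multiplied by [P >= 0]. *)
rewrite mulrCA; apply: le_trans (ler_wpM2l P0 SP).
by rewrite mulrBr lerB// expr2.
Qed.
End boundary_energy.

(** * Closure of [H1] under linear combinations *)

Section H1_space.
Context {R : realType} {n : nat}.
Local Notation V := 'rV[R]_n.+1.
Variable Omega : set V.

Lemma compact_support_bounded (K : set V) (f : V -> R) : compact K ->
  continuous f -> (forall x, ~ K x -> f x = 0) -> exists M, forall x, `|f x| <= M.
Proof.
move=> cK cf f0.
have /compact_bounded/pinfty_ex_gt0[M M0 fM] : compact (f @` K).
  by apply: continuous_compact => //; exact: continuous_subspaceT.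
exists M => x; have [Kx|/f0 ->] := pselect (K x); last by rewrite normr0 ltW.
by apply: fM; exists x.
Qed.

(** The complement of the compact support is open, so [phi] vanishes near each of its points and the
    derivative is zero there as well. *)
Lemma test_function_partial_bounded (phi : V -> R) i : test_function Omega phi ->
  exists M, forall x, `|partial i phi x| <= M.
Proof.
move=> [sphi [K [cK _ phi0]]]; have [cphi _] := sphi [:: i].
apply: (compact_support_bounded cK cphi) => x nKx.
transitivity ('D_('e_i) (cst 0 : V -> R) x); last exact: derive_cst.
apply: near_eq_derive.
have oK : open (~` K) by apply: closed_openC; exact: compact_closed (@norm_hausdorff _ _) cK.
by apply: filterS (open_nbhs_nbhs (conj oK nKx)) => y; exact: phi0.
Qed.

Hypothesis bOmega : bounded_set Omega.

(** Finite volume makes [f] integrable, and a bounded measurable factor preserves this. *)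
Lemma l2_mul_integrable (f g : V -> R) : l2 Omega f -> continuous g ->
  (exists M, forall x, `|g x| <= M) ->
  (volume Omega).-integrable setT (EFin \o (fun x => f x * g x)).
Proof.
move=> f2 cg [M gM]; apply: (integrable_mul_bounded (M := M)) => //.
  apply/Lfun1_integrable; apply: Lfun_subset12 f2.
  by rewrite ge0_fin_numE//; exact: volume_finite.
exact: continuous_measurable.
Qed.

(** Used to make [dt tau u k] an admissible test function. The weak gradient identities may be added
    once all four integrands are known to be integrable. *)
Lemma H1_lin a (u v : @fun_grad R n) : H1 Omega u -> H1 Omega v ->
  H1 Omega (a *: u + v).
Proof.
move=> [u2 gu2 wu] [v2 gv2 wv]; split.
- exact: Lfun2_lin.
- move=> i; have -> : (fun x => (a *: u + v).2 x 0 i) =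
      (fun x => a * u.2 x 0 i + v.2 x 0 i) by apply/funext => x; rewrite !mxE.
  exact: (Lfun2_lin a (gu2 i) (gv2 i)).
- move=> phi i tphi.
  have [sphi [K [cK _ phi0]]] := tphi.
  have pb : exists M, forall x, `|phi x| <= M.
    exact: compact_support_bounded cK (sphi [::]).1 phi0.
  have dpb := test_function_partial_bounded i tphi.
  have cphi : continuous phi := (sphi [::]).1.
  have cdphi : continuous (partial i phi) := (sphi [:: i]).1.
  have := wu phi i tphi; have := wv phi i tphi.
  have udI := l2_mul_integrable u2 cdphi dpb.
  have vdI := l2_mul_integrable v2 cdphi dpb.
  have guI := l2_mul_integrable (gu2 i) cphi pb.
  have gvI := l2_mul_integrable (gv2 i) cphi pb.
  move=> eqv equ.
  transitivity (a * \int[volume Omega]_x (u.1 x * partial i phi x) +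
     \int[volume Omega]_x (v.1 x * partial i phi x)).
    rewrite -RintegralZl// -RintegralD//; last exact: (integrableZl measurableT _ udI).
    by apply: eq_Rintegral => x _ /=; rewrite mulrDl -mulrA.
  rewrite equ eqv mulrN -opprD; congr (- _).
  rewrite -RintegralZl// -RintegralD//; last exact: (integrableZl measurableT _ guI).
  by apply: eq_Rintegral => x _ /=; rewrite !mxE mulrDl -mulrA.
Qed.

Lemma H1B u v : H1 Omega u -> H1 Omega v -> H1 Omega (u - v).
Proof. by move=> uH vH; rewrite addrC -scaleN1r; exact: H1_lin. Qed.

Lemma H1Z a u : H1 Omega u -> H1 Omega (a *: u).
Proof.
move=> uH; rewrite (_ : a *: u = (a - 1) *: u + u); first exact: H1_lin.
by rewrite scalerBl scale1r subrK.
Qed.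

End H1_space.

(** * Norms, the Dirichlet energy and traces *)

Section scalar_products.
Context {R : realType} {n : nat}.
Variable Omega : set 'rV[R]_n.+1.
Implicit Types u v w b : @fun_grad R n.

Lemma l2dot_ge0 u : 0 <= l2dot Omega u u.
Proof. by apply: Rintegral_ge0 => x _; rewrite -expr2 sqr_ge0. Qed.

Lemma sqr_l2norm u : l2norm Omega u ^+ 2 = l2dot Omega u u.
Proof. by rewrite sqr_sqrtr// l2dot_ge0. Qed.

Lemma dot_ge0 m (x : 'rV[R]_m) : 0 <= dot x x.
Proof. by apply: sumr_ge0 => i _; rewrite -expr2 sqr_ge0. Qed.

Lemma sqr_grad_norm u : grad_norm Omega u ^+ 2 = grad_dot Omega u u.
Proof. by rewrite sqr_sqrtr//; apply: Rintegral_ge0 => x _; exact: dot_ge0. Qed.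

Lemma l2norm_lin tau w b : H1 Omega w -> H1 Omega b ->
  l2norm Omega (tau *: w + b) ^+ 2 =
  l2norm Omega b ^+ 2 + 2 * tau * l2dot Omega w b + tau ^+ 2 * l2norm Omega w ^+ 2.
Proof. by move=> [w2 _ _] [b2 _ _]; rewrite !sqr_l2norm; exact: Rintegral_sqr_lin. Qed.

Lemma integrable_grad_dot u v : H1 Omega u -> H1 Omega v ->
  (volume Omega).-integrable setT (EFin \o (fun x => dot (u.2 x) (v.2 x))).
Proof.
move=> [_ gu _] [_ gv _].
rewrite (_ : EFin \o _ =
  fun x => (\sum_(i <- index_enum 'I_n.+1) (u.2 x 0 i * v.2 x 0 i)%:E)%E).
  by apply: integrable_sum => // i _; exact: (Lfun2_mul_integrable (gu i) (gv i)).
by apply/funext => x; rewrite sumEFin.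
Qed.

(** Pointwise, the right integrand exceeds the left one by the squared length of [tau] times the
    gradient of [w]. *)
Lemma grad_energy tau u w b : 0 < tau -> H1 Omega u -> H1 Omega w -> H1 Omega b ->
  u = tau *: w + b ->
  grad_norm Omega u ^+ 2 - grad_norm Omega b ^+ 2 <= 2 * tau * grad_dot Omega u w.
Proof.
move=> tau0 uH wH bH uE; rewrite !sqr_grad_norm.
have uuI := integrable_grad_dot uH uH; have bbI := integrable_grad_dot bH bH.
have uwI := integrable_grad_dot uH wH.
rewrite -RintegralB// -RintegralZl//; apply: le_Rintegral => //.
- exact: (integrableB measurableT uuI bbI).
- exact: (integrableZl measurableT _ uwI).
move=> x _; rewrite /dot mulr_sumr -sumrB; apply: ler_sum => i _.
have -> : b.2 x 0 i = u.2 x 0 i - tau * w.2 x 0 i by rewrite uE !mxE addrAC subrr add0r.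
rewrite -subr_ge0 (_ : _ - _ = (tau * w.2 x 0 i) ^+ 2) ?sqr_ge0//; ring.
Qed.

(* If no trace operator exists, [trace] is the default value [cst 0] of [xget],
   for which both lemmas hold as well. *)
Lemma trace_l2 u : H1 Omega u -> trace Omega u \in Lfun (surface Omega) 2%:E.
Proof.
rewrite /trace; case: xgetP => [T _ [Tl2 _ _ _]|_ _]; first exact: Tl2.
have [h _] := @Lfun_submod_closed _ _ _ (surface Omega) _ (lee1n 2).
exact: h.
Qed.

Lemma trace_lin a u v w : H1 Omega u -> H1 Omega v -> w = a *: u + v ->
  {ae surface Omega, forall x,
    trace Omega w x = a * trace Omega u x + trace Omega v x}.
Proof.
move=> uH vH ->; rewrite /trace.
case: xgetP => [T _ [_ Tlin _ _]|_]; first exact: Tlin.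
by apply: aeW => x; rewrite mulr0 addr0.
Qed.

End scalar_products.

(** * Energy and mass along the iterates *)

Section scheme_estimates.
Context {R : realType} {n : nat}.
Variables (Omega : set 'rV[R]_n.+1) (m eps tau : R).
Variable star : @fun_grad R n -> @fun_grad R n -> R.
Hypotheses (bOmega : bounded_set Omega) (m_gt0 : 0 < m) (eps_gt0 : 0 < eps).
Hypotheses (tau_gt0 : 0 < tau) (star_ip : H1_inner_product Omega star).
Implicit Type u : nat -> @fun_grad R n.

Lemma J_ge0 v : 0 <= J Omega m eps v.
Proof. by rewrite addr_ge0 ?sqr_ge0// mulr_ge0 ?sqr_ge0// invr_ge0 ltW. Qed.

Lemma sqr_star_norm v : H1 Omega v -> star_norm star v ^+ 2 = star v v.
Proof. by move=> vH; have [_ _ s0 _] := star_ip; rewrite sqr_sqrtr// s0. Qed.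

Lemma dtE u k : u k = tau *: dt tau u k + u k.-1.
Proof. by rewrite scalerA divff ?gt_eqF// scale1r subrK. Qed.

Lemma H1_dt u k : H1 Omega (u k) -> H1 Omega (u k.-1) -> H1 Omega (dt tau u k).
Proof. by move=> ukH ukH'; apply: H1Z => //; exact: H1B. Qed.

Lemma step_energy u k : H1 Omega (u k.-1) ->
  semi_implicit_step Omega m eps tau star u k ->
  J Omega m eps (u k) + 2 * tau * star_norm star (dt tau u k) ^+ 2
  <= J Omega m eps (u k.-1).
Proof.
move=> bH [uH orth weak]; have wH := H1_dt uH bH.
(* The orthogonality required by the scheme is the side condition on test functions. *)
have := weak _ wH orth; rewrite -sqr_star_norm// => {}weak.
have G := grad_energy tau_gt0 uH wH bH (dtE u k).
have Tu : {ae surface Omega, forall x, trace Omega (u k) x =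
    tau * trace Omega (dt tau u k) x + trace Omega (u k.-1) x}.
  exact: (trace_lin wH bH (dtE u k)).
have B := regabs_energy eps_gt0 tau_gt0 (trace_l2 uH) (trace_l2 bH) (trace_l2 wH) Tu.
have mV0 : 0 <= m^-1 by rewrite invr_ge0 ltW.
have := ler_wpM2l mV0 B.
rewrite /J /l1_bdry_reg in weak *.
set I := \int[_]_x (_ / _) in weak *; set L := \int[_]_x regabs _ _ in weak *.
set P := \int[_]_x regabs _ (trace _ (u k) _).
set S := star_norm _ _ ^+ 2 in weak *; set D := grad_dot _ _ _ in weak G.
(* The tested equation is scaled by [2 * tau] to match the gradient bound [G] and the boundary bound
   [B']. *)
move=> B'; have : 2 * tau * (S + D + m^-1 * L * I) = 0 by rewrite weak mulr0.
move: G B'; rewrite !mulrBr; lra.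
Qed.

(** Pythagoras: the cross term in the square of [tau *: dt tau u k + u k.-1] vanishes by
    orthogonality. *)
Lemma step_mass u k : H1 Omega (u k.-1) ->
  semi_implicit_step Omega m eps tau star u k ->
  l2norm Omega (u k) ^+ 2 =
  l2norm Omega (u k.-1) ^+ 2 + tau ^+ 2 * l2norm Omega (dt tau u k) ^+ 2.
Proof.
move=> bH [uH orth _].
by rewrite {1}(dtE u k) l2norm_lin ?orth ?mulr0 ?addr0//; exact: H1_dt.
Qed.

(** Membership in [H1] is carried through the induction because both one-step lemmas ask it of the
    previous iterate. *)
Lemma iterates_estimates (u0 : fun_grad) K u : H1 Omega u0 ->
  semi_implicit_iterates Omega m eps tau star u0 K u ->
  [/\ forall k, (k <= K)%N -> H1 Omega (u k),
      J Omega m eps (u K)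
        + 2 * tau * \sum_(1 <= k < K.+1) star_norm star (dt tau u k) ^+ 2
        <= J Omega m eps u0
    & l2norm Omega (u K) ^+ 2 = l2norm Omega u0 ^+ 2
        + tau ^+ 2 * \sum_(1 <= k < K.+1) l2norm Omega (dt tau u k) ^+ 2].
Proof.
move=> u0H; elim: K => [|K IH] [u00 step].
  by split=> [k||]; rewrite ?big_geq// ?mulr0 ?addr0 ?u00// leqn0 => /eqP ->; rewrite u00.
have [|uH E M] := IH; first by split=> // k /andP[k1 kK]; apply: step; rewrite k1 ltnW.
have sK : semi_implicit_step Omega m eps tau star u K.+1 by apply: step; rewrite /= leqnn.
have KH : H1 Omega (u K.+1.-1) by exact: uH.
split=> [k||].
- by rewrite leq_eqVlt => /predU1P[->|]; [case: sK|exact: uH].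
- rewrite big_nat_recr//= mulrDr addrCA addrC.
  have := step_energy KH sK => /=; lra.
- by rewrite big_nat_recr//= mulrDr addrA -M (step_mass KH sK).
Qed.

End scheme_estimates.

Theorem proposition3p2 (R : realType) (n : nat) (Omega : set 'rV[R]_n.+1)
    (m eps T cTr : R) (star : @fun_grad R n -> @fun_grad R n -> R)
    (u0 : @fun_grad R n) :
  bounded_lipschitz_domain Omega ->
  0 < m -> 0 < eps -> 0 < T -> 0 < cTr ->
  H1_inner_product Omega star ->
  (forall v, H1 Omega v ->
     (1 + eps) * l1_bdry Omega v ^+ 2
       <= cTr ^+ 2 * star_norm star v ^+ 2 + grad_norm Omega v ^+ 2) ->
  H1 Omega u0 -> l2norm Omega u0 ^+ 2 = 1 ->
  (forall (tau : R) (u : nat -> @fun_grad R n) (K : nat),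
     0 < tau -> K%:Z <= Num.floor (T / tau) ->
     semi_implicit_iterates Omega m eps tau star u0 K u ->
     [/\ J Omega m eps (u K)
           + 2 * (1 - cTr ^+ 2 * tau / (2 * m)) * tau
             * \sum_(1 <= k < K.+1) star_norm star (dt tau u k) ^+ 2
           <= J Omega m eps u0
              + eps / m * T * (1 + eps) * surface_area Omega ^+ 2,
         l2norm Omega (u K) ^+ 2
           = 1 + tau ^+ 2 * \sum_(1 <= k < K.+1) l2norm Omega (dt tau u k) ^+ 2
       & 1 <= l2norm Omega (u K)]) /\
  (forall cstar : R,
     (forall v, H1 Omega v -> l2norm Omega v <= cstar * star_norm star v) ->
     exists cU : R,
       forall (tau : R) (u : nat -> @fun_grad R n) (K : nat),
         0 < tau -> K%:Z <= Num.floor (T / tau) ->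
         semi_implicit_iterates Omega m eps tau star u0 K u ->
         `|l2norm Omega (u K) ^+ 2 - 1| <= cU * tau).
Proof.
move=> [_ _ _ bOmega _] m0 eps0 T0 _ ip _ u0H u01; split.
  move=> tau u K tau0 _ it.
  have [_ E M] := iterates_estimates bOmega m0 eps0 tau0 ip u0H it.
  have MK : 1 <= l2norm Omega (u K) ^+ 2.
    rewrite M u01 lerDl mulr_ge0 ?sqr_ge0// sumr_ge0// => k _; exact: sqr_ge0.
  split; last 2 first.
  - by rewrite M u01.
  - by rewrite -(@ler_sqr _ 1) ?nnegrE ?sqrtr_ge0// expr1n.
  set S := \sum_(1 <= k < K.+1) _ in E *.
  have S0 : 0 <= S by apply: sumr_ge0 => k _; exact: sqr_ge0.
  (* With [X = cTr ^+ 2 * tau / (2 * m)], the claimed left side is smaller than that of [E] by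
     [2 * tau * S * X >= 0]; the term added on the right is nonnegative. *)
  apply: (le_trans _ (le_trans E _)).
    have X0 : 0 <= cTr ^+ 2 * tau / (2 * m).
      by rewrite divr_ge0// mulr_ge0 ?sqr_ge0 ?(ltW tau0) ?(ltW m0).
    rewrite lerD2l -subr_ge0; set X := _ / _ in X0 *.
    rewrite (_ : _ - _ = 2 * (tau * S * X)); last by ring.
    exact: mulr_ge0 (ler0n _ 2) (mulr_ge0 (mulr_ge0 (ltW tau0) S0) X0).
  have eps1 : 0 <= 1 + eps by rewrite addr_ge0 ?(ltW eps0).
  rewrite lerDl; apply: mulr_ge0 (sqr_ge0 _); apply: mulr_ge0 eps1.
  by apply: mulr_ge0 (ltW T0); rewrite divr_ge0 ?(ltW eps0) ?(ltW m0).
(* The constant comes from [tau^2 Z <= tau^2 cstar^2 S], where [Z] and [S] sum the squares of the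
   [l2norm] and [star_norm] of the quotients, and from [2 tau S <= J(u0)]. *)
move=> cstar cstarP; exists (cstar ^+ 2 * J Omega m eps u0 / 2) => tau u K tau0 _ it.
have [uH E ->] := iterates_estimates bOmega m0 eps0 tau0 ip u0H it.
rewrite u01 addrAC subrr add0r.
set S := \sum_(1 <= k < K.+1) star_norm _ _ ^+ 2 in E.
set Z := \sum_(_ <= _ < _) _.
have Z0 : 0 <= Z by apply: sumr_ge0 => k _; exact: sqr_ge0.
have ZS : Z <= cstar ^+ 2 * S.
  rewrite /Z /S !big_nat mulr_sumr; apply: ler_sum => k /andP[k1 kK].
  have wH : H1 Omega (dt tau u k).
    apply: (H1_dt (Omega := Omega)) => //; apply: uH; first exact: kK.
    exact: leq_trans (leq_pred k) kK.
  have wle := cstarP _ wH; have w0 : 0 <= l2norm Omega (dt tau u k) by exact: sqrtr_ge0.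
  (* The right side of [wle] dominates a norm, so it is nonnegative for either sign of [cstar] and
     both sides may be squared. *)
  by rewrite -exprMn ler_sqr ?nnegrE// (le_trans w0).
rewrite ger0_norm; last exact: mulr_ge0 (sqr_ge0 _) Z0.
have Jge := J_ge0 Omega eps m0 (u K).
apply: (@le_trans _ _ (tau ^+ 2 * (cstar ^+ 2 * S))).
  by rewrite ler_wpM2l ?sqr_ge0.
have -> : tau ^+ 2 * (cstar ^+ 2 * S) = (cstar ^+ 2 * (2 * tau * S) / 2) * tau by field.
apply: ler_wpM2r; first exact: ltW.
rewrite ler_pM2r ?invr_gt0//; apply: ler_wpM2l; first exact: sqr_ge0.
by apply: le_trans E; rewrite lerDr.
Qed.
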